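(* Let $d\ge 2$, let $\mathbb{P}^{d-1}=\{(x,|x|^2):x\in[0,1]^{d-1}\}\subset\mathbb{R}^d$ and let $0<\alpha<d-1$. Assume that $\nu$ is a Borel probability measure supported on a subset of $\mathbb{P}^{d-1}$ whose Hausdorff dimension is $\alpha$, and that there is a constant $C>0$ such that $\nu(B(x,r))\le C r^{\alpha}$ for all $x\in\mathbb{P}^{d-1}$ and all $r>0$. Let $1\le p,q\le\infty$ and let $1/q+1/q'=1$. If $p<q'(d+1)/\alpha$, then the estimate $$\|\widehat{f\,d\nu}\|_{L^p(\mathbb{R}^d)}\le C_{p,q}\|f\|_{L^q(\nu)}\qquad\forall f\in L^q(\nu)$$ cannot hold for any finite constant $C_{p,q}$.
   Context: $B(x,r)$ is the closed ball of radius $r$ centered at $x$, and $\widehat{f\,d\nu}(\xi)=\int f(x)e^{-2\pi i x\cdot\xi}\,d\nu(x)$. When $q=1$, $q'(d+1)/\alpha$ is read as $\infty$. *)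

(* Defs.v *)
From HB Require Import structures.
From mathcomp Require Import all_boot all_order all_algebra.
From mathcomp Require Import complex.
From mathcomp Require Import all_classical all_reals all_analysis.

Set Implicit Arguments.
Unset Strict Implicit.
Unset Printing Implicit Defensive.
Import Order.TTheory GRing.Theory Num.Theory.
Import numFieldNormedType.Exports.

Local Open Scope classical_set_scope.
Local Open Scope ring_scope.

Section euclidean.
Context {R : realType} {n : nat}.
Implicit Types (x y : 'rV[R]_n) (A : set 'rV[R]_n).

Definition dotprod x y : R := \sum_(i < n) x 0 i * y 0 i.

(* The norm that 'rV[R]_n carries in the library is the sup norm. *)
Definition enorm x : R := Num.sqrt (dotprod x x).

Definition eclosed_ball x (r : R) : set 'rV[R]_n :=
  [set y | enorm (y - x) <= r].

Definition ediam A : \bar R :=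
  ereal_sup [set (enorm (p.1 - p.2))%:E | p in A `*` A].

End euclidean.

Section hausdorff.
Context {R : realType} {n : nat}.
Implicit Types (s delta : R) (A : set 'rV[R]_n).
Local Open Scope ereal_scope.

(* Empty covering sets are skipped: they must contribute 0 also when s = 0,
   and ediam set0 = -oo. *)
Definition hausdorff_premeasure s delta A : \bar R :=
  ereal_inf [set \sum_(k <oo | U k != set0) poweR (ediam (U k)) s
            | U in [set U : nat -> set 'rV[R]_n |
                    A `<=` \bigcup_k U k /\
                    forall k, ediam (U k) <= delta%:E]].

Definition hausdorff_measure s A : \bar R :=
  ereal_sup [set hausdorff_premeasure s delta A
            | delta in [set delta | (0 < delta)%R]].

Definition hausdorff_dim A : \bar R :=
  ereal_inf [set s%:E | s in [set s | (0 <= s)%R /\ hausdorff_measure s A = 0]].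

End hausdorff.

Definition borel_rV_display : measure_display. Proof. exact. Qed.

Section borel_rV.
Context (R : realType) (n : nat).

Let borel_rV : set (set 'rV[R]_n) := <<s open >>.

Let borel_rV0 : borel_rV set0.
Proof. exact: sigma_algebra0. Qed.

Let borel_rVC A : borel_rV A -> borel_rV (~` A).
Proof. exact: sigma_algebraC. Qed.

Let borel_rV_bigcup (F : (set 'rV[R]_n)^nat) :
  (forall i, borel_rV (F i)) -> borel_rV (\bigcup_i F i).
Proof. exact: sigma_algebra_bigcup. Qed.

HB.instance Definition _ := @isMeasurable.Build borel_rV_display
  'rV[R]_n borel_rV borel_rV0 borel_rVC borel_rV_bigcup.

End borel_rV.

Section borel_rV_theory.
Context {R : realType} {n : nat}.

Lemma open_measurable_rV (A : set 'rV[R]_n) : open A -> measurable A.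
Proof. by move=> oA; exact: sub_sigma_algebra. Qed.

Lemma measurable_coord_rV (i : 'I_n) :
  measurable_fun [set: 'rV[R]_n] (fun x : 'rV[R]_n => x 0 i).
Proof.
apply: (measurability _ (measurable_realfun.RGenOpens.measurableE R)) => _ [_ [a [b ->] <-]].
rewrite setTI; apply: open_measurable_rV; apply: open_comp.
  by move=> x _; exact: coord_continuous.
exact: interval_open.
Qed.

Let rbox (q : 'rV[rat]_n * 'rV[rat]_n) : set 'rV[R]_n :=
  [set x | forall i, ratr (q.1 0 i) < x 0 i < ratr (q.2 0 i)].

Lemma open_rV_bigcup (A : set 'rV[R]_n) : open A ->
  A = \bigcup_q (if `[< rbox q `<=` A >] then rbox q else set0).
Proof.
move=> oA; apply/seteqP; split=> [x Ax|x [q _]]; last first.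
  by case: ifPn => // /asboolP qA /qA.
have /nbhs_ballP[e /= e0 eA] : nbhs x A by exact: open_nbhs_nbhs.
have exa (i : 'I_n) : {a : rat | x 0 i - e < ratr a < x 0 i}.
  apply: cid; have /rat_in_itvoo[a /itvP ae] : x 0 i - e < x 0 i.
    by rewrite gtrBl.
  by exists a; rewrite !ae.
have exb (i : 'I_n) : {b : rat | x 0 i < ratr b < x 0 i + e}.
  apply: cid; have /rat_in_itvoo[b /itvP be] : x 0 i < x 0 i + e.
    by rewrite ltrDl.
  by exists b; rewrite !be.
pose q := (\row_i sval (exa i), \row_i sval (exb i)).
have qx : rbox q x.
  move=> i; rewrite /q /= !mxE.
  by case: (exa i) (exb i) => a /= /andP[_ ->] [b /= /andP[->]].
have qA : rbox q `<=` A.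
  move=> y qy; apply: eA; split => // i j; rewrite (ord1 i).
  have := qy j; rewrite /q /= !mxE /ball /= distrC ltr_distl.
  case: (exa j) (exb j) => a /= /andP[a1 a2] [b /= /andP[b1 b2]] /andP[ay yb].
  by rewrite (lt_trans a1 ay) (lt_trans yb b2).
by exists q => //; rewrite asboolT.
Qed.

Lemma measurable_fun_rV d (T : measurableType d) (f : T -> 'rV[R]_n) :
  (forall i, measurable_fun setT (fun t => f t 0 i)) -> measurable_fun setT f.
Proof.
move=> mf; apply: (@measurability _ _ T 'rV[R]_n setT f open) => // _ [A oA <-].
rewrite setTI (open_rV_bigcup oA) preimage_bigcup.
apply: countable_bigcupT_measurable => // q.
case: ifPn => _; last by rewrite preimage_set0.
rewrite [X in measurable X](_ : _ = \bigcap_(i in [set: 'I_n])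
    (fun t => f t 0 i) @^-1` `]ratr (q.1 0 i), ratr (q.2 0 i)[%classic).
  apply: fin_bigcap_measurable => // i _.
  by rewrite -[X in measurable X]setTI; exact: mf.
apply/seteqP; split=> t /= h i; first by move=> _; rewrite /= in_itv /= h.
by have := h i I; rewrite /= in_itv.
Qed.

End borel_rV_theory.

Section lebesgue_rV.
Context {R : realType}.

Definition cons_rV {n} (p : R * 'rV[R]_n) : 'rV[R]_n.+1 :=
  \row_i oapp (p.2 0) p.1 (unlift ord0 i).

Lemma cons_rV0 n (p : R * 'rV[R]_n) : cons_rV p 0 ord0 = p.1.
Proof. by rewrite mxE unlift_none. Qed.

Lemma cons_rVS n (p : R * 'rV[R]_n) i : cons_rV p 0 (lift ord0 i) = p.2 0 i.
Proof. by rewrite mxE liftK. Qed.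

Lemma measurable_cons_rV n : measurable_fun setT (@cons_rV n).
Proof.
apply: measurable_fun_rV => i; have [j|] := unliftP ord0 i => ->; last first.
  by under eq_fun do rewrite cons_rV0; exact: measurable_fst.
under eq_fun do rewrite cons_rVS.
exact: (measurableT_comp (measurable_coord_rV j) measurable_snd).
Qed.

Let uncons_rV {n} (y : 'rV[R]_n.+1) : R * 'rV[R]_n :=
  (y 0 ord0, \row_i y 0 (lift ord0 i)).

Let cons_rVK n : cancel (@cons_rV n) uncons_rV.
Proof.
move=> [x v]; rewrite /uncons_rV cons_rV0; congr pair.
by apply/rowP => i; rewrite mxE cons_rVS.
Qed.

Let measurable_uncons_rV n : measurable_fun setT (@uncons_rV n).
Proof.
apply: measurable_fun_pair; first exact: measurable_coord_rV.
apply: measurable_fun_rV => i; under eq_fun do rewrite mxE.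
exact: measurable_coord_rV.
Qed.

Section step.
Context {n : nat} (mu : {sigma_finite_measure set 'rV[R]_n -> \bar R}).
Local Open Scope ereal_scope.

Definition lebesgue_step : set 'rV[R]_n.+1 -> \bar R :=
  pushforward (@lebesgue_measure R \x mu) cons_rV.

HB.instance Definition _ := Measure.copy lebesgue_step
  (measure_function_pushforward__canonical__measure_function_Measure
     (@lebesgue_measure R \x mu) (@measurable_cons_rV n)).

Let lebesgue_step_sigma_finite : sigma_finite setT lebesgue_step.
Proof.
have /sigma_finiteP[F [FT ndF Foo]] := sigma_finiteT (@lebesgue_measure R).
have /sigma_finiteP[G [GT ndG Goo]] := sigma_finiteT mu.
exists (fun k => uncons_rV @^-1` (F k `*` G k)).
  apply/esym/seteqP; split=> // y _.
  have [i _ Fi] : (\bigcup_i F i) (uncons_rV y).1 by rewrite -FT.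
  have [j _ Gj] : (\bigcup_j G j) (uncons_rV y).2 by rewrite -GT.
  exists (maxn i j) => //; split.
    by move: Fi; exact/subsetPset/ndF/leq_maxl.
  by move: Gj; exact/subsetPset/ndG/leq_maxr.
move=> k; have [mF Fk] := Foo k; have [mG Gk] := Goo k; split.
  rewrite -[X in measurable X]setTI; apply: measurable_uncons_rV => //.
  exact: measurableX.
rewrite /lebesgue_step /pushforward /= (_ : _ @^-1` _ = F k `*` G k).
  by rewrite product_measure1E// lte_mul_pinfty// ge0_fin_numE.
by apply/seteqP; split=> p; rewrite /preimage /mkset cons_rVK.
Qed.

HB.instance Definition _ := Measure_isSigmaFinite.Build _ _ _
  lebesgue_step lebesgue_step_sigma_finite.

End step.

Fixpoint lebesgue_rV n : {sigma_finite_measure set 'rV[R]_n -> \bar R} :=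
  match n return {sigma_finite_measure set 'rV[R]_n -> \bar R} with
  | 0 => dirac (0 : 'rV[R]_0)
  | m.+1 => lebesgue_step (lebesgue_rV m)
  end.

End lebesgue_rV.

Section complex_analysis.
Context {R : realType}.

Definition expi (t : R) : R[i] := Complex (cos t) (sin t).

Section integral.
Context d {T : measurableType d} (mu : {measure set T -> \bar R}).
Implicit Types (f : T -> R[i]) (p : \bar R).

Definition cintegral f : R[i] :=
  Complex (\int[mu]_x complex.Re (f x)) (\int[mu]_x complex.Im (f x)).

Definition cLnorm p f : \bar R := Lnorm mu p (fun x => (ComplexField.Normc.normc (f x))%:E).

Definition cLp p f : Prop :=
  [/\ measurable_fun setT (fun x => complex.Re (f x)),
      measurable_fun setT (fun x => complex.Im (f x)) &
      (cLnorm p f < +oo)%E].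

End integral.

Definition fourier_measure n (nu : {measure set 'rV[R]_n -> \bar R})
    (f : 'rV[R]_n -> R[i]) (xi : 'rV[R]_n) : R[i] :=
  cintegral nu (fun x => f x * expi (- (2 * pi * dotprod x xi))).

(* The point (x, |x|^2) of R^d, whose first d - 1 coordinates are those of x:
   the index i = d - 1 is the only one on which insub fails. *)
Definition paraboloid_point d (x : 'rV[R]_d.-1) : 'rV[R]_d :=
  \row_(i < d) oapp (x 0) (enorm x ^+ 2) (insub (val i)).

Definition paraboloid d : set 'rV[R]_d :=
  @paraboloid_point d @` [set x : 'rV[R]_d.-1 | forall i, 0 <= x 0 i <= 1].

End complex_analysis.

Arguments paraboloid {R} d _.

(* Main.v *)
Require Import Defs.
From HB Require Import structures.
From mathcomp Require Import all_boot all_order all_algebra.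
From mathcomp Require Import complex ring lra.
From mathcomp Require Import all_classical all_reals all_analysis.
From mathcomp Require Import measurable_realfun ess_sup_inf.
Import Order.TTheory GRing.Theory Num.Theory.
Import numFieldNormedType.Exports.
Local Open Scope classical_set_scope.
Local Open Scope ring_scope.

(* Knapp's example. Since the support has dimension alpha, the mass distribution
   principle yields, for every s > alpha, arbitrarily small r and balls B(x, r)
   with nu(B(x, r)) > r^s. Test the estimate on the indicator function of such a
   ball. By
     (y - x).xi = sum_j (y_j - x_j) (xi_j + 2 x_j xi_d) + |y' - x'|^2 xi_d
   the phase is nearly constant on the ball for xi in a sheared box of volume
   comparable to r^-(d+1), so that the left-hand side of the estimate is at least
   of order nu(B) r^(-(d+1)/p), while the right-hand side is nu(B)^(1/q).
   Hence r^(s/q' - (d+1)/p) stays bounded as r -> 0, whereas the exponent is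
   negative if s is close to alpha. *)

(** * Euclidean norm and closed balls *)

Section euclidean_norm.
Context (R : realType) (n : nat).
Implicit Types (x y : 'rV[R]_n).

Lemma dotprod_ge0 x : 0 <= dotprod x x.
Proof. by apply: sumr_ge0 => i _; rewrite -expr2 sqr_ge0. Qed.

Lemma enorm0 : enorm (0 : 'rV[R]_n) = 0.
Proof.
by rewrite /enorm /dotprod big1 ?sqrtr0// => i _; rewrite mxE mul0r.
Qed.

Lemma coord_le_enorm x i : `|x 0 i| <= enorm x.
Proof.
rewrite -sqrtr_sqr ler_sqrt ?dotprod_ge0// /dotprod (bigD1 i)//= -expr2.
by rewrite lerDl sumr_ge0// => j _; rewrite -expr2 sqr_ge0.
Qed.

Lemma measurable_eclosed_ball x r : measurable (eclosed_ball x r).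
Proof.
rewrite -[eclosed_ball x r]setTI (_ : eclosed_ball x r =
  (fun y => enorm (y - x)) @^-1` `]-oo, r]%classic); last first.
  by apply/seteqP; split => y /=; rewrite in_itv.
have mdot : measurable_fun setT (fun y => dotprod (y - x) (y - x)).
  apply: measurable_sum => i; have mi : measurable_fun setT
      (fun y : 'rV[R]_n => (y - x) 0 i).
    under eq_fun do rewrite !mxE; apply: measurable_funD => //.
    exact: measurable_coord_rV.
  exact: measurable_funM.
have msqrt : measurable_fun setT (@Num.sqrt R).
  apply: continuous_measurable_fun; exact: sqrt_continuous.
by apply: (measurableT_comp msqrt mdot).
Qed.

End euclidean_norm.

(** * The mass distribution principle *)

(** By contradiction: a set of diameter r meeting [E] lies, up to points outside [E], in the closed
    ball of radius r about one of its points in [E]. If all small balls had mass at most r^s, a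
    cover of [E] with sum of diam^s below 1 would force the total mass of [nu] below 1. *)
Lemma mass_distribution (R : realType) (n : nat) (nu : probability 'rV[R]_n R)
    (E : set 'rV[R]_n) (s r0 : R) :
  0 < s -> 0 < r0 -> nu.-negligible (~` E) -> hausdorff_measure s E = 0%E ->
  exists x r, [/\ E x, 0 < r <= r0 &
    ((r `^ s)%:E < nu (eclosed_ball x r))%E].
Proof.
move=> s0 r00 [N [mN N0 EN]] HE; apply: contrapT => noball.
have ball_le x r : E x -> 0 < r <= r0 -> (nu (eclosed_ball x r) <= (r `^ s)%:E)%E.
  move=> Ex rr0; rewrite leNgt; apply/negP => h; apply: noball.
  by exists x, r; split.
(* Sets of diameter 0 count for 0^s = 0 in the cover, so the bound on balls has to be extended to
   radius 0. *)
have point_le x : E x -> (nu (eclosed_ball x 0) <= 0)%E.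
  move=> Ex; apply/lee_addgt0Pr => e e0; rewrite add0e.
  pose r := Num.min r0 (e `^ s^-1).
  have rgt0 : 0 < r by rewrite lt_min r00 powR_gt0.
  apply: (@le_trans _ _ (nu (eclosed_ball x r))).
    apply: le_measure; rewrite ?inE; [exact: measurable_eclosed_ball..|].
    by move=> y /= /le_trans; apply; exact: ltW.
  apply: (le_trans (ball_le _ _ Ex _)); first by rewrite rgt0 ge_min lexx.
  have eE : e = (e `^ s^-1) `^ s by rewrite -powRrM mulVf ?gt_eqF// powRr1// ltW.
  rewrite lee_fin [leRHS]eE; apply: ge0_ler_powR; rewrite ?nnegrE ?powR_ge0 ?(ltW s0) ?(ltW rgt0)//.
  by rewrite /r ge_min lexx orbT.
have /ereal_inf_lt[_ [U [EU Ur] <-]] : (hausdorff_premeasure s r0 E < 1)%E.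
  rewrite (@le_lt_trans _ _ 0%E)// -[leRHS]HE.
  by apply: ereal_sup_ubound; exists r0.
rewrite ltNge => /negP; apply.
(* Neither [E] nor [U k] need be measurable, so the trace of [U k] on [E] is enclosed in a
   measurable set, either empty or a closed ball. *)
have cover k : {c : set 'rV[R]_n | [/\ measurable c, E `&` U k `<=` c &
    (nu c <= if U k != set0 then poweR (ediam (U k)) s else 0)%E]}.
  apply: cid; have [[x [Ex Ux]]|noEU] := pselect (E `&` U k !=set0); last first.
    exists set0; split=> //; first by move=> y h; apply: noEU; exists y.
    by rewrite measure0; case: ifP => // _; exact: poweR_ge0.
  have Uk0 : U k != set0 by apply/set0P; exists x.
  have d0 : (0 <= ediam (U k))%E.
    by apply: ereal_sup_ubound; exists (x, x) => //=; rewrite subrr enorm0.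
  have dfin : ediam (U k) \is a fin_num.
    by rewrite ge0_fin_numE// (le_lt_trans (Ur k))// ltry.
  exists (eclosed_ball x (fine (ediam (U k)))); split.
  - exact: measurable_eclosed_ball.
  - move=> y [Ey Uy]; rewrite /eclosed_ball /= -lee_fin fineK//.
    by apply: ereal_sup_ubound; exists (y, x).
  rewrite Uk0; move: d0 (Ur k); rewrite -(fineK dfin) !lee_fin /=.
  rewrite le_eqVlt => /predU1P[<- _|d0 dr]; last by apply: ball_le; rewrite ?d0.
  by rewrite powR0 ?gt_eqF// point_le.
pose c k := sval (cover k).
have mc k : measurable (c k) by rewrite /c; case: (cover k) => ? [].
have nuN : nu (~` N) = 1%E by rewrite probability_setC// N0 sube0.
(* The complement of [N] is measurable, has mass 1 and is contained in [E], hence in the union of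
   the [c k]. *)
rewrite -nuN eseries_mkcond; apply: le_trans (_ : \sum_(k <oo) nu (c k) <= _)%E.
  apply: measure_sigma_subadditive => //; first exact: measurableC.
  move=> y Ny; have Ey : E y by apply: contrapT => /EN.
  have [k _ Uk] := EU _ Ey; exists k => //.
  by rewrite /c; case: (cover k) => ? /= [_ + _]; apply.
apply: lee_nneseries => // k _.
by rewrite /c; case: (cover k) => ? /= [].
Qed.

(** * Volume of sheared boxes *)

(** Fubini: over each [v] in [S] the section is an interval of length 2L centred at [- a v], so the
    shear does not affect the volume. *)
Lemma lebesgue_step_slab (R : realType) (n : nat)
    (mu : {sigma_finite_measure set 'rV[R]_n -> \bar R})
    (A : set 'rV[R]_n.+1) (S : set 'rV[R]_n) (a : 'rV[R]_n -> R) (L : R) :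
  0 <= L -> measurable A -> measurable S ->
  (forall t v, A (cons_rV (t, v)) <-> S v /\ `|t + a v| <= L) ->
  lebesgue_step mu A = ((2 * L)%:E * mu S)%E.
Proof.
move=> L0 mA mS AE.
have mX : measurable (cons_rV @^-1` A).
  by rewrite -[X in measurable X]setTI; exact: measurable_cons_rV.
rewrite /lebesgue_step /pushforward.
(* The order of integration is exchanged, so that the sections in [t] are measured first. *)
rewrite (product_measure_unique (m' := (@lebesgue_measure R \x^ mu)%E))//; last first.
  by move=> ? ? ? ?; exact: product_measure2E.
rewrite /product_measure2.
transitivity (\int[mu]_y ((2 * L)%:E * (\1_S y)%:E))%E; last first.
  by rewrite ge0_integralZl_EFin ?mulr_ge0// ?integral_indic ?setIT//; apply/measurable_EFinP.
apply: eq_integral => v _ /=.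
rewrite indicE; have [/set_mem Sv|/negP Sv] := boolP (v \in S).
  rewrite (_ : ysection _ _ = `[- a v - L, - a v + L]%classic).
    rewrite lebesgue_measure_itv/= lte_fin; case: ltP => // h.
      by rewrite mule1 -EFinB; congr EFin; ring.
    have -> : L = 0 by lra.
    by rewrite mulr0 mule1.
  apply/seteqP; split => t; rewrite /ysection /= in_itv /=.
    by rewrite inE /= => /AE[_]; rewrite ler_norml => /andP[? ?]; apply/andP; split; lra.
  move=> /andP[? ?]; rewrite inE /=; apply/AE; split => //.
  by rewrite ler_norml; apply/andP; split; lra.
rewrite mule0 (_ : ysection _ _ = set0) ?measure0//.
apply/seteqP; split => t //; rewrite /ysection /= inE /= => /AE[Sv' _].
by apply: Sv; rewrite inE.
Qed.

(* With b_j = 2 x_j this is the parallelepiped dual to the cap of radius r of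
   the paraboloid at x, when L is of order 1/r and M of order 1/r^2. *)
Definition shear_box {R : realType} {m : nat} (b : 'I_m -> R) (L M : R) :
    set 'rV[R]_m.+1 :=
  [set xi | `|xi 0 ord_max| <= M /\
    forall j, `|xi 0 (widen_ord (leqnSn m) j) + b j * xi 0 ord_max| <= L].

Lemma measurable_shear_box (R : realType) (m : nat) (b : 'I_m -> R) (L M : R) :
  measurable (shear_box b L M).
Proof.
have mle (f : 'rV[R]_m.+1 -> R) c : measurable_fun setT f ->
    measurable [set x | `|f x| <= c].
  move=> mf; rewrite [X in measurable X](_ : _ = f @^-1` `[- c, c]).
    by rewrite -[X in measurable X]setTI; exact: mf.
  by apply/seteqP; split => x /=; rewrite in_itv /= ler_norml.
rewrite [X in measurable X](_ : _ = [set xi : 'rV[R]_m.+1 | `|xi 0 ord_max| <= M] `&`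
  \bigcap_(j in [set: 'I_m])
    [set xi | `|xi 0 (widen_ord (leqnSn m) j) + b j * xi 0 ord_max| <= L]); last first.
  apply/seteqP; split => x [h k]; split => // j; first by move=> _; exact: k.
  exact: (k j).
apply: measurableI; first by apply: mle; apply: measurable_coord_rV.
apply: fin_bigcap_measurable => // j _; apply: mle.
apply: measurable_funD; first exact: measurable_coord_rV.
by apply: measurable_funM => //; exact: measurable_coord_rV.
Qed.

(** Induction peeling off the first coordinate, which gives a slab of width 2L sheared by the last
    coordinate; in the end only the interval of length 2M for the last coordinate is left. *)
Lemma lebesgue_shear_box (R : realType) (m : nat) (b : 'I_m -> R) (L M : R) :
  0 <= L -> 0 <= M ->
  lebesgue_rV m.+1 (shear_box b L M) = (2 * M * (2 * L) ^+ m)%:E.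
Proof.
move=> L0 M0; elim: m b => [|m IH] b.
  rewrite [LHS](@lebesgue_step_slab _ _ (lebesgue_rV 0) _ setT (fun=> 0) M)//.
  - by rewrite /= /lebesgue_rV diracT mule1 expr0 mulr1.
  - exact: measurable_shear_box.
  move=> t v; rewrite /shear_box /= (_ : ord_max = ord0) ?cons_rV0 ?addr0; last exact/val_inj.
  by split=> [[]//|[_ ?]]; split => // -[].
pose b' (j : 'I_m) := b (lift ord0 j).
have maxE : ord_max = lift ord0 ord_max :> 'I_m.+2 by apply/val_inj.
rewrite [LHS](@lebesgue_step_slab _ _ (lebesgue_rV m.+1) _ (shear_box b' L M)
  (fun v => b ord0 * v 0 ord_max) L)//.
- by rewrite IH -EFinM exprS; congr EFin; ring.
- exact: measurable_shear_box.
- exact: measurable_shear_box.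
move=> t v; rewrite /shear_box /= maxE cons_rVS.
have w0 : widen_ord (leqnSn m.+1) ord0 = ord0 by apply/val_inj.
have wS j : widen_ord (leqnSn m.+1) (lift ord0 j) =
  lift ord0 (widen_ord (leqnSn m) j) by apply/val_inj.
split=> [[hM h]|[[hM h] h0]].
  split; last by have := h ord0; rewrite w0 cons_rV0.
  by split=> // j; have := h (lift ord0 j); rewrite wS cons_rVS.
split=> // j; have [j'|] := unliftP ord0 j => ->; last by rewrite w0 cons_rV0.
by rewrite wS cons_rVS; exact: h.
Qed.

(** * The phase on a cap of the paraboloid *)

Lemma paraboloid_ord_max (R : realType) (m : nat) (x : 'rV[R]_m.+1) : paraboloid m.+1 x ->
  x 0 ord_max = \sum_(j < m) x 0 (widen_ord (leqnSn m) j) ^+ 2.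
Proof.
move=> [y _ <-]; rewrite !mxE insubF /= ?ltnn// sqr_sqrtr; last first.
  by apply: sumr_ge0 => i _; rewrite -expr2 sqr_ge0.
apply: eq_bigr => j _; rewrite !mxE -expr2 (_ : insub _ = Some j)//.
by rewrite /= insubT//= => ?; congr Some; apply/val_inj.
Qed.

Lemma paraboloid_phase (R : realType) (m : nat) (x y xi : 'rV[R]_m.+1) :
  paraboloid m.+1 x -> paraboloid m.+1 y ->
  dotprod y xi - dotprod x xi =
  let d j :=
    y 0 (widen_ord (leqnSn m) j) - x 0 (widen_ord (leqnSn m) j) in
  \sum_(j < m) d j * (xi 0 (widen_ord (leqnSn m) j) +
     2 * x 0 (widen_ord (leqnSn m) j) * xi 0 ord_max) +
  (\sum_(j < m) d j ^+ 2) * xi 0 ord_max.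
Proof.
move=> Px Py /=.
rewrite /dotprod !big_ord_recr /= (paraboloid_ord_max R m x Px) (paraboloid_ord_max R m y Py).
have sumD (u v : 'I_m -> R) : \sum_j u j + \sum_j v j = \sum_j (u j + v j).
  by rewrite big_split.
rewrite !mulr_suml !sumD -sumrB.
by apply: eq_bigr => j _; ring.
Qed.

(** Each of the [m] linear terms is at most r times k/r and the quadratic term is at most r^2 times
    k/r^2, which makes m + 1 contributions of size at most [k]. *)
Lemma paraboloid_phase_le (R : realType) (m : nat) (x y xi : 'rV[R]_m.+1) (r k : R) :
  0 < r -> 0 <= k -> paraboloid m.+1 x -> paraboloid m.+1 y -> eclosed_ball x r y ->
  shear_box (fun j => 2 * x 0 (widen_ord (leqnSn m) j)) (k / r) (k / r ^+ 2) xi ->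
  `|dotprod y xi - dotprod x xi| <= m.+1%:R * k.
Proof.
move=> r0 k0 Px Py xyr [xiM xiL]; rewrite paraboloid_phase//=.
pose d j := y 0 (widen_ord (leqnSn m) j) - x 0 (widen_ord (leqnSn m) j).
rewrite -[X in `|X|]/(\sum_(j < m) d j * (xi 0 (widen_ord (leqnSn m) j) +
  2 * x 0 (widen_ord (leqnSn m) j) * xi 0 ord_max) +
  (\sum_(j < m) d j ^+ 2) * xi 0 ord_max).
have dr j : `|d j| <= r.
  apply: le_trans xyr; apply: le_trans (coord_le_enorm _ _ _ (widen_ord (leqnSn m) j)).
  by rewrite !mxE.
have d2r : \sum_(j < m) d j ^+ 2 <= r ^+ 2.
  apply: (@le_trans _ _ (enorm (y - x) ^+ 2)); last first.
    by rewrite lerXn2r ?nnegrE ?sqrtr_ge0// ltW.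
  rewrite sqr_sqrtr ?dotprod_ge0// /dotprod big_ord_recr /=.
  rewrite ler_wpDr// -?expr2 ?sqr_ge0//.
  by apply: ler_sum => j _; rewrite !mxE expr2.
rewrite -(natr1 m) mulrDl mul1r; apply: le_trans (ler_normD _ _) _; apply: lerD.
  apply: le_trans (ler_norm_sum _ _ _) _.
  rewrite mulr_natl -[m in leRHS]card_ord -sumr_const; apply: ler_sum => j _.
  rewrite normrM (_ : k = r * (k / r)); last by field; rewrite gt_eqF.
  exact: ler_pM.
rewrite normrM ger0_norm ?sumr_ge0//; last by move=> j _; rewrite sqr_ge0.
rewrite (_ : k = r ^+ 2 * (k / r ^+ 2)); last by field; rewrite gt_eqF.
by apply: ler_pM => //; rewrite sumr_ge0// => j _; rewrite sqr_ge0.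
Qed.

(** * Fourier transform of an indicator function *)

(** The left-hand side is the real part of (a + bi) e^(it). *)
Lemma normc_ge_rotate (R : realType) (a b t : R) :
  a * cos t - b * sin t <= ComplexField.Normc.normc (Complex a b).
Proof.
rewrite /ComplexField.Normc.normc; apply: le_trans (ler_norm _) _.
rewrite -sqrtr_sqr ler_sqrt ?addr_ge0 ?sqr_ge0//.
have := cos2Dsin2 t; have := sqr_ge0 (a * sin t + b * cos t); nra.
Qed.

Section fourier_lower_bound.
Context (R : realType) (n : nat) (nu : probability 'rV[R]_n R).

Lemma measurable_dotprod (xi : 'rV[R]_n) :
  measurable_fun setT (fun y : 'rV[R]_n => dotprod y xi).
Proof.
by apply: measurable_sum => i; apply: measurable_funM => //; exact: measurable_coord_rV.
Qed.

Let integrable_bounded (g : 'rV[R]_n -> R) : measurable_fun setT g ->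
  (forall y, `|g y| <= 1) -> nu.-integrable setT (EFin \o g).
Proof.
move=> mg g1; apply: measurable_bounded_integrable => //.
  by rewrite /= probability_setT ltry.
by exists 1; split => // M M1 y _ /=; apply: le_trans (g1 y) (ltW M1).
Qed.

(** Multiplied by e^(i t0), the transform has as real part the integral over [B] of cos(2 pi y.xi -
    t0), to which the pointwise bound applies. *)
Lemma fourier_measure_indic_ge (B : set 'rV[R]_n) (xi : 'rV[R]_n) (t0 : R) :
  measurable B ->
  (forall y, B y -> 2^-1 <= cos (2 * pi * dotprod y xi - t0)) ->
  2^-1 * fine (nu B) <=
  ComplexField.Normc.normc (fourier_measure nu (fun y => Complex (\1_B y) 0) xi).
Proof.
move=> mB Bt0; rewrite /fourier_measure /cintegral /=.
apply: le_trans (normc_ge_rotate _ _ _ t0).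
pose t y := - (2 * pi * dotprod y xi).
have mt : measurable_fun setT t.
  by apply: measurableT_comp => //; apply: measurable_funM => //; exact: measurable_dotprod.
have mind : measurable_fun setT (\1_B : 'rV[R]_n -> R) by exact: measurable_indic.
have ind1 y : `|\1_B y| <= 1 :> R by rewrite indicE; case: (_ \in _); rewrite ?normr1 ?normr0.
have mcos : measurable_fun setT (@cos R) by apply: continuous_measurable_fun; exact: continuous_cos.
have msin : measurable_fun setT (@sin R) by apply: continuous_measurable_fun; exact: continuous_sin.
have icos : nu.-integrable setT (EFin \o (fun y => \1_B y * cos (t y))).
  apply: integrable_bounded => [|y].
    by apply: measurable_funM => //; exact: (measurableT_comp mcos mt).
  by rewrite normrM mulr_ile1 ?cos_max.
have isin : nu.-integrable setT (EFin \o (fun y => \1_B y * sin (t y))).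
  apply: integrable_bounded => [|y].
    by apply: measurable_funM => //; exact: (measurableT_comp msin mt).
  by rewrite normrM mulr_ile1 ?sin_max.
have iind : nu.-integrable setT (EFin \o (\1_B : 'rV[R]_n -> R)) by exact: integrable_bounded.
have iM (f : 'rV[R]_n -> R) c : nu.-integrable setT (EFin \o f) ->
    nu.-integrable setT (EFin \o (fun y => f y * c)).
  exact: integrableZr.
have -> : fine (nu B) = \int[nu]_y (\1_B y).
  by rewrite /Rintegral integral_indic// setIT.
have -> : \int[nu]_y complex.Re (Complex (\1_B y) 0 * expi (t y)) =
    \int[nu]_y (\1_B y * cos (t y)).
  by apply: eq_Rintegral => y _ /=; rewrite mul0r subr0.
have -> : \int[nu]_y complex.Im (Complex (\1_B y) 0 * expi (t y)) =
    \int[nu]_y (\1_B y * sin (t y)).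
  by apply: eq_Rintegral => y _ /=; rewrite mul0r addr0.
rewrite mulrC -!RintegralZr// -RintegralB//=; [|exact: iM..].
apply: le_Rintegral => //; first exact: iM.
  by apply: (integrableB measurableT (f := EFin \o _) (g := EFin \o _)); exact: iM.
move=> y _; rewrite -!mulrA -mulrBr indicE.
have [/set_mem By|_] := boolP (y \in B); last by rewrite !mul0r.
by rewrite !mul1r -cosD -cosN opprD opprK; exact: Bt0.
Qed.
End fourier_lower_bound.

(** * Bounds for Lebesgue norms *)

Section Lnorm_bounds.
Context d (T : measurableType d) (R : realType) (mu : {measure set T -> \bar R}).

(* Argued with simple functions below f: monotonicity of the integral in the
   library would require the Fourier transform to be shown measurable. *)
Lemma integral_ge_cstM (A : set T) (c : R) (f : T -> \bar R) :
  measurable A -> 0 <= c -> (forall x, (0 <= f x)%E) ->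
  (forall x, A x -> (c%:E <= f x)%E) -> (c%:E * mu A <= \int[mu]_x f x)%E.
Proof.
move=> mA c0 f0 Af; rewrite ge0_integralTE//; apply: ereal_sup_ubound => /=.
exists (scale_nnsfun (indic_nnsfun R mA) c0).
  move=> x; rewrite [leLHS](_ : _ = (c * \1_A x)%:E)// indicE.
  have [/set_mem/Af|_] := boolP (x \in A).
    by rewrite mulr1.
  by rewrite mulr0.
by rewrite [LHS](sintegralrM mu c (indic_nnsfun R mA)) sintegral_indic.
Qed.

(** Chebyshev's inequality: integrate c^p <= |f|^p over [A] and take p-th roots. *)
Lemma Lnorm_ge_cst (A : set T) (c p : R) (f : T -> \bar R) :
  measurable A -> 0 <= c -> 0 < p -> (forall x, A x -> (c%:E <= `|f x|)%E) ->
  (c%:E * poweR (mu A) p^-1 <= Lnorm mu p%:E f)%E.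
Proof.
move=> mA c0 p0 Af; rewrite unlock /=.
have cE : c%:E = poweR ((c `^ p)%:E) p^-1.
  by rewrite poweR_EFin -powRrM mulfV ?gt_eqF// powRr1.
rewrite [X in (X * _)%E]cE -poweRM ?lee_fin ?powR_ge0//.
have ge0int : (0 <= \int[mu]_x poweR `|f x| p)%E.
  by apply: integral_ge0 => x _; exact: poweR_ge0.
apply: gt0_ler_poweR; rewrite ?invr_ge0 ?(ltW p0)//.
- by rewrite in_itv /= leey andbT mule_ge0// lee_fin powR_ge0.
- by rewrite in_itv /= leey andbT.
apply: integral_ge_cstM => //; first exact: powR_ge0.
  by move=> x; exact: poweR_ge0.
move=> x /Af h; rewrite -poweR_EFin; apply: gt0_ler_poweR => //; rewrite ?ltW//.
  by rewrite in_itv /= leey lee_fin c0.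
by rewrite in_itv /= leey abse_ge0.
Qed.

End Lnorm_bounds.

(* For q = +oo the exponent fine q^-1 is 0. *)
Lemma cLnorm_indic_le d (T : measurableType d) (R : realType)
    (mu : probability T R) (B : set T) (q : \bar R) :
  measurable B -> (1 <= q)%E ->
  (cLnorm mu q (fun y => Complex (\1_B y)%R 0%R) <= poweR (mu B) (fine q^-1))%E.
Proof.
move=> mB; have normE y : ComplexField.Normc.normc (Complex (\1_B y) 0) = \1_B y :> R.
  rewrite /ComplexField.Normc.normc expr0n addr0 sqrtr_sqr ger0_norm//.
rewrite /cLnorm (_ : (fun y => _) = EFin \o \1_B); last first.
  by apply/funext => y; rewrite normE.
case: q => [q| |]//; last first.
  move=> _; rewrite unlock /= probability_setT lte01 /inve /= poweRe0.
  apply/ess_supP; apply: aeW => y /=; rewrite lee_fin indicE.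
  by case: (_ \in _); rewrite ?normr1 ?normr0.
rewrite lee_fin => q1; have q0 : q != 0 by rewrite gt_eqF// (lt_le_trans ltr01).
rewrite unlock /inve (negbTE q0) /=.
rewrite (_ : \int[mu]_x _ = mu B)%E//.
transitivity (\int[mu]_y (\1_B y)%:E)%E; last by rewrite integral_indic// setIT.
apply: eq_integral => y _ /=; rewrite indicE.
by case: (_ \in _); rewrite ?normr1 ?powR1// normr0 powR0.
Qed.

(** * The Knapp lower bound *)

Lemma cos_ge_half (R : realType) :
  exists2 k : R, 0 < k & forall t, `|t| <= k -> 2^-1 <= cos t.
Proof.
have := @continuous_cos R 0; rewrite /continuous_at cos0 => h.
have /nbhs_ballP[e /= e0 he] : \forall t \near nbhs (0 : R), 2^-1 < cos t.
  by apply: (cvgr_gt 1 h); lra.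
exists (e / 2); first by rewrite divr_gt0.
move=> t te; apply/ltW/he; rewrite /ball /= sub0r normrN; lra.
Qed.

(** [k] is small enough for the phase to stay within [kappa] of its value at the centre [x]. [B]
    need only lie in the ball, which leaves room for removing a null set. *)
Lemma knapp_lower_bound (R : realType) (m : nat) (nu : probability 'rV[R]_m.+1 R)
    (p kappa k r : R) (x : 'rV[R]_m.+1) (B : set 'rV[R]_m.+1) :
  0 < p -> 0 < k -> 2 * pi * m.+1%:R * k <= kappa ->
  (forall t, `|t| <= kappa -> 2^-1 <= cos t) ->
  0 < r -> paraboloid m.+1 x -> measurable B -> B `<=` paraboloid m.+1 ->
  B `<=` eclosed_ball x r ->
  ((2^-1 * fine (nu B) *
    (((2 * k) ^+ m.+1) `^ p^-1 * r `^ (- (m.+2%:R / p))))%R%:E <=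
  cLnorm (lebesgue_rV m.+1) p%:E (fourier_measure nu (fun y => Complex (\1_B y)%R 0%R)))%E.
Proof.
move=> p0 k0 k_kappa hcos r0 Px mB BP Bx.
pose A := shear_box (fun j => 2 * x 0 (widen_ord (leqnSn m) j)) (k / r) (k / r ^+ 2).
(* The volume of the box is (2k)^(m+1) r^(-(m+2)), where m + 2 = d + 1. *)
have -> : ((2 * k) ^+ m.+1) `^ p^-1 * r `^ (- (m.+2%:R / p)) =
    (2 * (k / r ^+ 2) * (2 * (k / r)) ^+ m) `^ p^-1.
  rewrite -mulNr powRrM -powRM ?exprn_ge0 ?powR_ge0 ?mulr_ge0 ?(ltW k0)//.
  congr (_ `^ _); rewrite powR_invn ?ltW// !exprMn exprVn !exprS.
  by field; rewrite expf_neq0 gt_eqF.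
rewrite EFinM -poweR_EFin -(lebesgue_shear_box _ _
  (fun j => 2 * x 0 (widen_ord (leqnSn m) j))) ?divr_ge0 ?exprn_ge0 ?(ltW k0) ?(ltW r0)//.
apply: Lnorm_ge_cst => //.
- exact: measurable_shear_box.
- by rewrite mulr_ge0// fine_ge0.
move=> xi Axi /=; rewrite lee_fin; apply: le_trans (ler_norm _).
apply: (@fourier_measure_indic_ge _ _ _ _ _ (2 * pi * dotprod x xi)) => // y By.
apply: hcos; rewrite -mulrBr normrM ger0_norm ?mulr_ge0 ?pi_ge0//.
have := paraboloid_phase_le _ _ _ _ _ _ _ r0 (ltW k0) Px (BP _ By) (Bx _ By) Axi.
move=> /(ler_wpM2l (mulr_ge0 (ler0n R 2) (pi_ge0 R))) /le_trans; apply.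
by rewrite mulrA.
Qed.

(** * Exponents and conclusion *)

(** With theta = 1/q', the condition p < q'c becomes p theta < c. This covers q = 1 as well, where
    q' is infinite and theta is 0. *)
Lemma conjugate_exponent_fine (R : realType) (q q' : \bar R) :
  (1 <= q)%E -> (q^-1 + q'^-1 = 1)%E ->
  [/\ 0 <= fine q'^-1 <= 1, fine q^-1 = 1 - fine q'^-1 &
   forall p c : R, 0 < p -> 0 < c -> (p%:E < q' * c%:E)%E -> p * fine q'^-1 < c].
Proof.
move=> hq hqq'.
have [a [qE a01]] : exists a : R, (q^-1 = a%:E)%E /\ 0 <= a <= 1.
  case: q hq {hqq'} => [q| |]//; last by exists 0; split=> //; rewrite lexx ler01.
  rewrite lee_fin => q1; have q0 : 0 < q by rewrite (lt_le_trans ltr01).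
  exists q^-1; rewrite /inve gt_eqF//; split=> //.
  by rewrite invr_ge0 ltW//= invf_le1.
have q'E : (q'^-1 = (1 - a)%:E)%E.
  move: hqq'; rewrite qE; case: (q'^-1)%E => [b| |]// [ab].
  by congr EFin; lra.
rewrite q'E qE /=; split; [by apply/andP; split; lra|by rewrite opprB addrC subrK|].
move=> p c p0 c0; move: q'E; case: q' {hqq'} => [b| |]//; last first.
  move=> [<-]; first by rewrite mulr0.
rewrite /inve; case: eqVneq => // b0 [bE].
have bgt0 : 0 < b by rewrite lt0r b0 -invr_ge0 bE; lra.
by rewrite -bE -EFinM lte_fin ltr_pdivrMr// mulrC.
Qed.

Theorem theorem1p3 (R : realType) (d : nat) (hd : (2 <= d)%N)
  (alpha : R) (halpha : 0 < alpha < d%:R - 1)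
  (nu : probability 'rV[R]_d R)
  (hsupp : exists E : set 'rV[R]_d,
     [/\ E `<=` paraboloid d, hausdorff_dim E = alpha%:E &
         nu.-negligible (~` E)])
  (hball : exists2 C : R, 0 < C &
     forall (x : 'rV[R]_d) (r : R), paraboloid d x -> 0 < r ->
       (nu (eclosed_ball x r) <= (C * r `^ alpha)%:E)%E)
  (p q q' : \bar R) (hp : (1 <= p)%E) (hq : (1 <= q)%E)
  (hqq' : (q^-1 + q'^-1 = 1)%E)
  (hpq : (p < q' * ((d%:R + 1) / alpha)%:E)%E) :
  ~ exists C : R, forall f : 'rV[R]_d -> R[i], cLp nu q f ->
      (cLnorm (lebesgue_rV d) p (fourier_measure nu f) <= C%:E * cLnorm nu q f)%E.
Proof.
case: d => [//|m] in hd halpha nu hsupp hball hpq *.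
case: hsupp => E [EP dimE [N [mN N0 EN]]] [C estimate].
case/andP: halpha => alpha0 _ {hd hball}.
case: p hp hpq estimate => [p| |]//; last by move=> _; rewrite ltNge leey.
rewrite lee_fin => p1 hpq estimate; have p0 : 0 < p by rewrite (lt_le_trans ltr01).
have [] := conjugate_exponent_fine _ _ _ hq hqq'.
set theta := fine q'^-1 => /andP[theta0 theta1] qE /(_ _ _ p0 _ hpq).
rewrite divr_gt0 ?ltr_wpDl// natr1 => /(_ isT) ptheta {hqq' hpq}.
have {}ptheta : alpha * theta < m.+2%:R / p.
  by move: ptheta; rewrite !ltr_pdivlMr// => h; lra.
(* Half the gap: since theta <= 1, any s < alpha + eps still has s theta below (d + 1)/p. *)
pose eps := (m.+2%:R / p - alpha * theta) / 2.
have eps0 : 0 < eps by rewrite divr_gt0// subr_gt0.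
have [_ [s [s0 Hs] <-]] : exists2 y, [set s%:E | s in [set s | 0 <= s /\
    hausdorff_measure s E = 0%E]] y & (y < (alpha + eps)%:E)%E.
  by apply: ereal_inf_lt; rewrite -/(hausdorff_dim E) dimE lte_fin ltrDl.
rewrite lte_fin => s_lt.
(* This gives s > 0, as the mass distribution principle requires. *)
have alpha_s : alpha <= s.
  by rewrite -lee_fin -dimE; apply: ereal_inf_lbound; exists s.
have stheta : s * theta < m.+2%:R / p.
  apply: (@le_lt_trans _ _ (alpha * theta + eps)); last by rewrite /eps; lra.
  apply: (@le_trans _ _ ((alpha + eps) * theta)).
    by rewrite ler_wpM2r// ltW.
  by rewrite mulrDl lerD2l ler_piMr// ltW.
pose gamma := m.+2%:R / p - s * theta.
have gamma0 : 0 < gamma by rewrite subr_gt0.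
have [kappa kappa0 hcos] := cos_ge_half R.
have pi0 : 0 < 2 * pi * m.+1%:R :> R by rewrite !mulr_gt0// pi_gt0.
(* The largest [k] that the phase tolerance [kappa] admits. *)
pose k := kappa / (2 * pi * m.+1%:R).
have k0 : 0 < k by rewrite divr_gt0.
(* [a] is the constant of the Knapp bound and [K] satisfies a K = |C| + 1. The radius will be at
   most K^(-1/gamma), which forces r^(-gamma) >= K. *)
pose a := 2^-1 * (((2 * k) ^+ m.+1) `^ p^-1).
have a0 : 0 < a by rewrite mulr_gt0// powR_gt0// exprn_gt0// mulr_gt0.
pose K := (`|C| + 1) / a.
have K0 : 0 < K by rewrite divr_gt0 ?ltr_wpDl.
have [x [r [Ex /andP[r0 rK] ball_gt]]] := mass_distribution _ _ nu E s (K `^ (- gamma^-1))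
  (lt_le_trans alpha0 alpha_s) (powR_gt0 _ K0) (ex_intro _ N (And3 mN N0 EN)) Hs.
(* The support E need not be measurable; off the null set N it contains B. *)
pose B := eclosed_ball x r `\` N.
have mb : measurable (eclosed_ball x r) by exact: measurable_eclosed_ball.
have mB : measurable B by exact: measurableD.
have BP : B `<=` paraboloid m.+1.
  by move=> y [_ Ny]; apply: EP; apply: contrapT => /EN.
have nuB : nu B = nu (eclosed_ball x r).
  have mbN : measurable (eclosed_ball x r `&` N) by exact: measurableI.
  have bN0 : nu (eclosed_ball x r `&` N) = 0%E by apply: subset_measure0 N0.
  by apply/esym; rewrite -[RHS]adde0 -bN0; exact: measureDI.
have Bfin : nu B \is a fin_num by exact: fin_num_measure.
pose b := fine (nu B).
have b_gt : r `^ s < b by rewrite -lte_fin fineK// nuB.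
have b0 : 0 < b by rewrite (le_lt_trans _ b_gt)// powR_ge0.
pose f : 'rV[R]_m.+1 -> R[i] := fun y => Complex (\1_B y) 0.
have fle : (cLnorm nu q f <= (b `^ (1 - theta))%:E)%E.
  have := cLnorm_indic_le _ _ _ nu B q mB hq.
  by rewrite qE -(fineK Bfin) poweR_EFin.
have fLp : cLp nu q f.
  split; [exact: measurable_indic|exact: measurable_cst|].
  by apply: le_lt_trans fle _; rewrite ltry.
(* The sign of [C] is not known, hence the passage to |C|. *)
have lower : ((a * b * r `^ (- (m.+2%:R / p)))%:E <= (`|C| * b `^ (1 - theta))%:E)%E.
  apply: (@le_trans _ _ (cLnorm (lebesgue_rV m.+1) p%:E (fourier_measure nu f))).
    rewrite (_ : a * b * _ = 2^-1 * b * (((2 * k) ^+ m.+1) `^ p^-1 * r `^ (- (m.+2%:R / p)))).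
      apply: (knapp_lower_bound _ _ nu p kappa k r x) => //.
      - by rewrite /k mulrC divfK// gt_eqF.
      - exact: EP.
      - by move=> y [].
    by rewrite /a; ring.
  apply: le_trans (estimate _ fLp) _; rewrite EFinM.
  apply: (@le_trans _ _ (`|C|%:E * cLnorm nu q f)%E).
    by apply: lee_wpmul2r; rewrite ?Lnorm_ge0// lee_fin ler_norm.
  by apply: lee_wpmul2l => //; rewrite lee_fin.
(* The chain is |C| < a K <= a r^(-gamma) <= a b^theta r^(-(d+1)/p) <= |C|; its last link is [lower]
   divided by b^(1 - theta). *)
have : `|C| < `|C|; last by rewrite ltxx.
apply: (@lt_le_trans _ _ (a * K)); first by rewrite /K mulrC divfK ?gt_eqF// ltrDl.
have Kr : K <= r `^ (- gamma).
  rewrite powRN -[K]invrK lef_pV2 ?posrE ?powR_gt0 ?invr_gt0//.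
  rewrite -(powR_inv1 (ltW K0)) (_ : -1 = - gamma^-1 * gamma); last first.
    by rewrite mulNr mulVf// gt_eqF.
  by rewrite [leRHS]powRrM; apply: ge0_ler_powR; rewrite ?nnegrE ?powR_ge0 ?(ltW gamma0) ?(ltW r0).
apply: (@le_trans _ _ (a * r `^ (- gamma))); first by rewrite ler_pM2l.
(* Here the choice of the ball enters, through r^s < b. *)
have rb : r `^ (s * theta) <= b `^ theta.
  by rewrite powRrM; apply: ge0_ler_powR; rewrite ?nnegrE ?powR_ge0 ?(ltW b0) ?(ltW b_gt).
rewrite /gamma opprB powRD; last by rewrite (gt_eqF r0) implybT.
apply: (@le_trans _ _ (a * (b `^ theta * r `^ (- (m.+2%:R / p))))).
  by rewrite ler_pM2l// ler_wpM2r// powR_ge0.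
move: lower; rewrite lee_fin -(ler_pM2r (powR_gt0 (theta - 1) b0)).
rewrite -[leRHS]mulrA -powRD; last by rewrite (gt_eqF b0) implybT.
have -> : 1 - theta + (theta - 1) = 0 by ring.
have bE : b `^ theta = b * b `^ (theta - 1).
  by rewrite mulrC -[X in _ * X](powRr1 (ltW b0)) -powRD ?subrK// (gt_eqF b0) implybT.
by rewrite powRr0 mulr1 bE => h; lra.
Qed.
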